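(* Let $\mathfrak C$ be a left cancellative small category. Then $\mathrm{Iso}(\bar I_l\ltimes\partial\Omega)^\circ=\bar I_l^c\ltimes\partial\Omega$ (the interior of the isotropy subgroupoid). Moreover, the following are equivalent: (i) $I_l\,\bar\ltimes\,\partial\Omega\cong\bar I_l\ltimes\partial\Omega$ is effective. (ii) $\bar I_l^c\ltimes\partial\Omega=\partial\Omega$. (iii) For all $s\in\bar I_l^c$ there exist $\varepsilon_1,\dots,\varepsilon_n\in\bar{\mathcal J}$ with $s\varepsilon_i=\varepsilon_i$ for all $1\le i\le n$ such that for all $g\in\mathcal J$ with $\emptyset\ne g\le s^{-1}s$ there exists $1\le i\le n$ with $g\varepsilon_i\ne\emptyset$.
   Context: $\mathfrak C$ denotes the set of morphisms, $\mathfrak C^0\subseteq\mathfrak C$ the identity morphisms, $\mathfrak d,\mathfrak t$ domain and target; $cd$ is defined iff $\mathfrak d(c)=\mathfrak t(d)$; left cancellative means $cx=cy\Rightarrow x=y$. Each $c\in\mathfrak C$ gives the partial bijection $\mathfrak d(c)\mathfrak C\to c\mathfrak C$, $x\mapsto cx$; $I_l$ is the smallest semigroup of partial bijections of $\mathfrak C$ containing these and closed under inverses; $\mathcal J=\{\mathrm{dom}(s):s\in I_l\}$ is its semilattice of idempotents. $\bar{\mathcal J}$ is the set of subsets $\varepsilon=e\setminus\bigcup_{i=1}^nf_i$ of $\mathfrak C$ with $e,f_1,\dots,f_n\in\mathcal J$, $f_i\subseteq e$. $\bar I_l$ is the inverse semigroup of all partial bijections $s\varepsilon$ (restriction of $s$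 to $\varepsilon$) with $s\in I_l$, $\varepsilon\in\bar{\mathcal J}$, $\varepsilon\subseteq\mathrm{dom}(s)$; its semilattice of idempotents is $\bar{\mathcal J}$. Idempotents are identified with subsets of $\mathfrak C$: products are intersections, $\le$ is inclusion, $s^{-1}s=\mathrm{dom}(s)$, $ses^{-1}=s(e\cap\mathrm{dom}(s))$, and $s\varepsilon=\varepsilon$ means $\varepsilon\subseteq\mathrm{dom}(s)$ and $s(x)=x$ for $x\in\varepsilon$. $\widehat{\mathcal J}$ is the space of non-zero multiplicative maps $\chi:\mathcal J\to\{0,1\}$ with $\chi(\emptyset)=0$ if $\emptyset\in\mathcal J$ (pointwise convergence). $\Omega\subseteq\widehat{\mathcal J}$ consists of those $\chi$ such that whenever $e=\bigcup_{i=1}^nf_i$ ($e,f_i\in\mathcal J$) and $\chi(e)=1$, then $\chi(f_i)=1$ for some $i$. For $\chi\in\Omega$, $\varepsilon=e\setminus\bigcup f_i\in\bar{\mathcal J}$, put $\chi(\varepsilon)=1$ iff $\chi(e)=1$ and all $\chi(f_i)=0$, and $\chi(\varepsilon)=0$ otherwise. $\partial\Omega\subseteq\Omega$ is the closure of the set $\Omega_{\max}$ of $\chi\in\widehat{\mathcal J}$ with $\chi^{-1}(1)$ maximal. $\bar I_l$ acts on $\Omega$ and $\partial\Omega$: $s$ maps $\{\chi(s^{-1}s)=1\}$ onto $\{\chi(ss^{-1})=1\}$ by $(s.\chi)(f)=\chi(s^{-1}fs)$. $\bar I_l\ltimes\partial\Omega$ is the groupoid of classes $[s,\chi]$ with $s\in\bar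 I_l$, $\chi\in\partial\Omega$, $\chi(s^{-1}s)=1$, where $[s,\chi]=[t,\psi]$ iff $\chi=\psi$ and $s\varepsilon=t\varepsilon$ for some $\varepsilon\in\bar{\mathcal J}$ with $\chi(\varepsilon)=1$; source $\chi$, range $s.\chi$; topology such that the sets $\{[s,\chi]:\chi(s^{-1}s)=1\}$ are open and mapped homeomorphically by the source map onto $\{\chi\in\partial\Omega:\chi(s^{-1}s)=1\}$. $I_l\,\bar\ltimes\,\partial\Omega$ is defined in the same way with $s\in I_l$ only (same equivalence relation); the inclusion $I_l\subseteq\bar I_l$ induces an isomorphism $I_l\,\bar\ltimes\,\partial\Omega\cong\bar I_l\ltimes\partial\Omega$. $\bar I_l^f:=\{s\in\bar I_l:\exists f\in\mathcal J,\ \emptyset\ne f\le s^{-1}s\}$; $\bar I_l^c:=\{s\in\bar I_l^f: e(ses^{-1})\ne\emptyset\ \forall e\in\mathcal J\text{ with }\emptyset\ne e\le s^{-1}s\}$; $\bar I_l^c\ltimes\partial\Omega:=\{[s,\chi]\in\bar I_l\ltimes\partial\Omega:s\in\bar I_l^c\}$. An étale groupoid is effective if the interior of its isotropy subgroupoid equals its unit space. *)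

(* Defs.v *)
From HB Require Import structures.
From mathcomp Require Import all_boot all_classical.
From mathcomp Require Import topology.

Set Implicit Arguments.
Unset Strict Implicit.
Unset Printing Implicit Defensive.

Local Open Scope classical_set_scope.

(** A small category in its arrows-only presentation: objects are identified
    with their identity morphisms, and [comp c d] is meaningful only when
    [dom c = tgt d]. *)
Record smallCategory := SmallCategory {
  mor :> Type;
  dom : mor -> mor;
  tgt : mor -> mor;
  comp : mor -> mor -> mor;
  dom_dom : forall c, dom (dom c) = dom c;
  tgt_dom : forall c, tgt (dom c) = dom c;
  dom_tgt : forall c, dom (tgt c) = tgt c;
  tgt_tgt : forall c, tgt (tgt c) = tgt c;
  dom_comp : forall c d, dom c = tgt d -> dom (comp c d) = dom d;
  tgt_comp : forall c d, dom c = tgt d -> tgt (comp c d) = tgt c;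
  comp_dom : forall c, comp c (dom c) = c;
  comp_tgt : forall c, comp (tgt c) c = c;
  compA : forall c d e, dom c = tgt d -> dom d = tgt e ->
    comp c (comp d e) = comp (comp c d) e
}.

Definition left_cancellative (C : smallCategory) : Prop :=
  forall c x y : C, dom c = tgt x -> dom c = tgt y ->
    comp c x = comp c y -> x = y.

Record lcCategory := LCCategory {
  lc_cat :> smallCategory;
  lc_cancel : left_cancellative lc_cat
}.

(** Partial bijections of [T] are represented by their graphs. The library's
    relational operations give the semigroup structure: [s^-1] is the inverse,
    [s \; t] is the product [st] (first [t], then [s]), and the projection
    [s.`1] is the domain [s^{-1}s]. *)
Section PartialBijections.
Variable T : Type.
Local Open Scope relation_scope.
Implicit Types (s t : set (T * T)) (A : set T).

Definition partial_bijection s : Prop :=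
  (forall x y z, s (x, y) -> s (x, z) -> y = z) /\
  (forall x y z, s (x, z) -> s (y, z) -> x = y).

(** The idempotent attached to a subset. *)
Definition pid A : set (T * T) := [set p | A p.1 /\ p.1 = p.2].

(** The product [s A]. *)
Definition restr s A : set (T * T) := s \; pid A.

(** [s A s^{-1}], as a subset. *)
Definition pimage s A : set T := [set y | exists2 x, A x & s (x, y)].

(** [s^{-1} A s], as a subset. *)
Definition ppreimage s A : set T := [set x | exists2 y, s (x, y) & A y].

Definition inverse_semigroup (S : set (set (T * T))) : Prop :=
  (forall s t, S s -> S t -> S (s \; t)) /\ (forall s, S s -> S s^-1).

Lemma restrE s A x y : restr s A (x, y) <-> A x /\ s (x, y).
Proof.
split=> [|[Ax sxy]]; last by exists x.
by case=> z [/= Ax <-].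
Qed.

Lemma restr_dom s A : (restr s A).`1 = A `&` s.`1.
Proof.
apply/seteqP; split=> x /=.
  by move=> [y /restrE [Ax sxy]]; split=> //; exists y.
by move=> [Ax [y sxy]]; exists y; apply/restrE.
Qed.

Lemma pid_dom A : (pid A).`1 = A.
Proof. by apply/seteqP; split=> x /= => [[y [] //]|Ax]; exists x. Qed.

Lemma pidI A B : pid A \; pid B = pid (A `&` B).
Proof.
apply/seteqP; split=> -[x y] /=.
  by move=> [z [/= Ax <-] [/= Bx <-]].
by move=> [/= [Ax Bx] <-]; exists x.
Qed.

Lemma ppreimageI s A B : ppreimage s A `&` B = ppreimage (restr s B) A.
Proof.
apply/seteqP; split=> x /=.
  by move=> [[y sxy Ay] Bx]; exists y => //; apply/restrE.
by move=> [y /restrE[Bx sxy] Ay]; split=> //; exists y.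
Qed.

Lemma restr_restr s A B : restr (restr s A) B = restr s (A `&` B).
Proof.
apply/seteqP; split=> -[x y].
  by move=> /restrE[Bx /restrE[Ax sxy]]; apply/restrE.
by move=> /restrE[[Ax Bx] sxy]; apply/restrE; split=> //; apply/restrE.
Qed.

End PartialBijections.

Section InverseHull.
Variable C : lcCategory.
Local Open Scope relation_scope.

(** The partial bijection [x |-> cx]. *)
Definition lmul (c : C) : set (C * C) :=
  [set p | dom c = tgt p.1 /\ p.2 = comp c p.1].

Definition Il : set (set (C * C)) :=
  smallest (@inverse_semigroup C) (range lmul).

Definition J : set (set C) := [set s.`1 | s in Il].

Definition Jbar : set (set C) :=
  [set eps | exists (e : J) (n : nat) (f : 'I_n -> J),
    (forall i, val (f i) `<=` val e) /\
    eps = val e `\` \bigcup_i val (f i)].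

Definition Ibar : set (set (C * C)) :=
  [set t | exists s eps,
    [/\ Il s, Jbar eps, eps `<=` s.`1 & t = restr s eps]].

Definition Ibar_f : set (set (C * C)) :=
  [set s | Ibar s /\ exists f, [/\ J f, f !=set0 & f `<=` s.`1]].

Definition Ibar_c : set (set (C * C)) :=
  [set s | Ibar_f s /\
    forall e, J e -> e !=set0 -> e `<=` s.`1 -> (e `&` pimage s e) !=set0].

Lemma Il_comp s t : Il s -> Il t -> Il (s \; t).
Proof.
by move=> sI tI S SP; have [[SM _] _] := SP; exact: SM (sI S SP) (tI S SP).
Qed.

Lemma Il_inv s : Il s -> Il s^-1.
Proof. by move=> sI S SP; have [[_ SV] _] := SP; exact: SV (sI S SP). Qed.

Lemma Il_partial_bijection : Il `<=` @partial_bijection C.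
Proof.
apply: smallest_sub.
  split=> [s t [s1 s2] [t1 t2]|s [s1 s2]].
    split=> x y z [/= u tu su] [/= v tv sv].
      by move: sv; rewrite (t1 _ _ _ tv tu); exact: s1.
    by move: tv; rewrite (s2 _ _ _ sv su); exact: t2.
  by split=> x y z /=; [exact: s2 | exact: s1].
move=> _ [c _ <-]; split=> x y z [/= cx xE] [/= cy yE].
  by rewrite xE yE.
by apply: (@lc_cancel C c) => //; rewrite -xE -yE.
Qed.

Lemma Il_pid e : J e -> Il (pid e).
Proof.
move=> [s sI <-].
have [s1 s2] := Il_partial_bijection sI.
suff -> : pid s.`1 = s^-1 \; s by exact: Il_comp (Il_inv sI) sI.
apply/seteqP; split=> -[x y] /=.
  by move=> [/= [z sxz] <-]; exists z.
by move=> [z /= sxz syz]; split=> /=; [exists z | exact: s2 sxz syz].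
Qed.

Lemma JI e f : J e -> J f -> J (e `&` f).
Proof.
move=> eJ fJ; exists (pid e \; pid f); first exact: Il_comp (Il_pid eJ) (Il_pid fJ).
by rewrite pidI pid_dom setIC.
Qed.

Definition Jmeet (e f : J) : J :=
  SigSub (mem_set (JI (set_valP e) (set_valP f))).

(** All maps [J -> {0, 1}], with the topology of pointwise convergence. *)
Definition Char := {ptws J -> bool}.

Definition Jhat : set Char :=
  [set chi : Char |
    [/\ exists e, chi e,
        forall e f, chi (Jmeet e f) = chi e && chi f
      & forall e, val e = set0 -> chi e = false]].

Definition Omega : set Char :=
  [set chi : Char | Jhat chi /\
    forall (e : J) (n : nat) (f : 'I_n -> J),
      val e = \bigcup_i val (f i) -> chi e -> exists i, chi (f i)].

Definition Omega_max : set Char :=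
  [set chi : Char | Jhat chi /\
    forall psi : Char, Jhat psi ->
      [set e | chi e] `<=` [set e | psi e] ->
      [set e | psi e] = [set e | chi e]].

(** The closure is taken in the subspace [Jhat]. *)
Definition bOmega : set Char := Jhat `&` closure Omega_max.

(** [chi(eps) = 1] for [eps] in [Jbar]. For [chi] in [Omega] this does not
    depend on how [eps] is written, see [evE]. *)
Definition ev (chi : Char) (eps : set C) : Prop :=
  exists (e : J) (n : nat) (f : 'I_n -> J),
    [/\ forall i, val (f i) `<=` val e,
        eps = val e `\` \bigcup_i val (f i),
        chi e
      & forall i, chi (f i) = false].

Definition act (s : set (C * C)) (chi : Char) : Char :=
  fun f => `[< ev chi (ppreimage s (val f)) >].

Lemma ev_Jbar chi eps : ev chi eps -> Jbar eps.
Proof. by move=> [e [n [f [fe -> _ _]]]]; exists e, n, f. Qed.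

Definition Jcat (e e' : J) n m (f : 'I_n -> J) (f' : 'I_m -> J) :
    'I_(n + m) -> J :=
  fun k => match fintype.split k with
           | inl i => Jmeet (f i) e'
           | inr j => Jmeet (f' j) e
           end.

Lemma Jcat_setD (e e' : J) n m (f : 'I_n -> J) (f' : 'I_m -> J) :
  (val e `\` \bigcup_i val (f i)) `&` (val e' `\` \bigcup_i val (f' i)) =
  val (Jmeet e e') `\` \bigcup_i val (Jcat e e' f f' i).
Proof.
apply/seteqP; split=> x.
  move=> [[ex fx] [e'x f'x]]; split=> [//|[k _]]; rewrite /Jcat.
  by case: fintype.split => i /= [? ?]; [apply: fx; exists i | apply: f'x; exists i].
move=> [[ex e'x] nx]; split; split=> // -[i _ fx]; apply: nx.
  by exists (unsplit (inl i)); rewrite // /Jcat unsplitK.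
by exists (unsplit (inr i)); rewrite // /Jcat unsplitK.
Qed.

Lemma Jcat_sub (e e' : J) n m (f : 'I_n -> J) (f' : 'I_m -> J) :
  (forall i, val (f i) `<=` val e) -> (forall i, val (f' i) `<=` val e') ->
  forall i, val (Jcat e e' f f' i) `<=` val (Jmeet e e').
Proof.
move=> fe fe' k x; rewrite /Jcat; case: fintype.split => i /= [fx ?]; split => //.
  exact: fe fx.
exact: fe' fx.
Qed.

Lemma JbarI a b : Jbar a -> Jbar b -> Jbar (a `&` b).
Proof.
move=> [e [n [f [fe ->]]]] [e' [m [f' [fe' ->]]]].
exists (Jmeet e e'), (n + m), (Jcat e e' f f').
by rewrite Jcat_setD; split=> //; exact: Jcat_sub.
Qed.

Lemma J_Jbar e : J e -> Jbar e.
Proof.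
move=> eJ; exists (SigSub (mem_set eJ)), 0, (fun=> SigSub (mem_set eJ)).
by split=> [[]//|]; rewrite bigcup0 ?setD0 // => -[].
Qed.

Lemma ev_meet chi a b : Jhat chi -> ev chi a -> ev chi b -> ev chi (a `&` b).
Proof.
move=> [_ chiM _] [e [n [f [fe -> chie chif]]]] [e' [m [f' [fe' -> chie' chif']]]].
exists (Jmeet e e'), (n + m), (Jcat e e' f f').
rewrite Jcat_setD; split=> //; first exact: Jcat_sub.
  by rewrite chiM chie.
by move=> k; rewrite /Jcat; case: fintype.split => i; rewrite chiM ?chif ?chif'.
Qed.

Lemma Omega_split chi (e : J) n (f : 'I_n -> J) : Omega chi ->
  val e `<=` \bigcup_i val (f i) -> chi e -> exists i, chi (f i).
Proof.
move=> [[_ chiM _] chiU] ef chie.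
have /chiU : val e = \bigcup_i val (Jmeet e (f i)).
  apply/seteqP; split=> [x ex|x [i _ []//]].
  by have [i _ fx] := ef _ ex; exists i.
by move=> /(_ chie)[i]; rewrite chiM => /andP[_ ?]; exists i.
Qed.

Lemma ev_sup chi a (e : J) : Omega chi -> a `<=` val e -> ev chi a -> chi e.
Proof.
move=> chiO ae [e' [n [f [fe aE chie' chif]]]]; rewrite {}aE in ae.
have [[_ chiM _] _] := chiO.
pose g (k : 'I_n.+1) := if unlift ord0 k is Some i then f i else Jmeet e' e.
have /(Omega_split chiO) /(_ chie')[k] : val e' `<=` \bigcup_i val (g i).
  move=> x ex; have [[i _ fx]|fx] := pselect ((\bigcup_i val (f i)) x).
    by exists (lift ord0 i); rewrite // /g liftK.
  by exists ord0; rewrite // /g unlift_none; split=> //; exact: ae.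
rewrite /g; case: unlift => [i|]; first by rewrite chif.
by rewrite chiM => /andP[].
Qed.

Lemma ev_J chi (e : J) : Omega chi -> ev chi (val e) <-> chi e.
Proof.
move=> chiO; split=> [|chie]; first exact: ev_sup.
exists e, 0, (fun=> e); split; [by case | | by [] | by case].
by rewrite bigcup0 ?setD0 // => -[].
Qed.

Lemma evE chi (e : J) n (f : 'I_n -> J) : Omega chi ->
  (forall i, val (f i) `<=` val e) ->
  ev chi (val e `\` \bigcup_i val (f i)) <->
  chi e /\ forall i, chi (f i) = false.
Proof.
move=> chiO fe; split=> [eva|[chie chif]]; last by exists e, n, f.
split; first by apply: (ev_sup chiO) eva; exact: subDsetl.
move=> i; apply/negbTE/negP => /(ev_J _ chiO) evf.
have [e' [m [f' [_ aE chie' chif']]]] := ev_meet chiO.1 eva evf.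
have /(Omega_split chiO) : val e' `<=` \bigcup_i val (f' i).
  rewrite -setD_eq0 -aE; apply/seteqP; split=> // x [[_ nf] fx].
  by apply: nf; exists i.
by move=> /(_ chie')[j]; rewrite chif'.
Qed.

Lemma ev_le chi a b : Omega chi -> Jbar b -> a `<=` b -> ev chi a -> ev chi b.
Proof.
move=> chiO [e [n [f [fe ->]]]] ab eva; apply/evE => //; split.
  by apply: (ev_sup chiO) eva => x /ab[].
move=> i; apply/negbTE/negP => /(ev_J _ chiO) evf.
have [e' [m [f' [_ aE chie' chif']]]] := ev_meet chiO.1 eva evf.
have /(Omega_split chiO) : val e' `<=` \bigcup_i val (f' i).
  rewrite -setD_eq0 -aE; apply/seteqP; split=> // x [/ab[_ nf] fx].
  by apply: nf; exists i.
by move=> /(_ chie')[j]; rewrite chif'.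
Qed.

Lemma Omega_max_disj chi (f : J) : Omega_max chi -> chi f = false ->
  exists2 h : J, chi h & val h `&` val f = set0.
Proof.
move=> [[[e0 chie0] chiM chi0] chimax] chif; apply: contrapT => nh.
pose psi : Char := fun g => `[< exists2 h : J, chi h & val h `&` val f `<=` val g >].
suff psiP : Jhat psi.
  have := chimax _ psiP; rewrite /psi => E; move: chif.
  suff : [set e | chi e] f by move=> /= ->.
  rewrite -E; first by apply/asboolP; exists e0.
  by move=> g /= chig; apply/asboolP; exists g.
split.
- by exists e0; apply/asboolP; exists e0.
- move=> e e'; apply/asboolP/andP => [[h chih hf]|[/asboolP[h chih hf]]].
    by split; apply/asboolP; exists h => // x /hf[].
  move=> /asboolP[h' chih' hf']; exists (Jmeet h h'); first by rewrite chiM chih.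
  by move=> x [[? ?] ?]; split; [exact: hf | exact: hf'].
- move=> e e0E; apply/asboolP => -[h chih]; rewrite e0E subset0 => hf.
  by apply: nh; exists h.
Qed.

Lemma Omega_max_disjs chi n (f : 'I_n -> J) : Omega_max chi ->
  (forall i, chi (f i) = false) ->
  exists2 h : J, chi h & val h `&` \bigcup_i val (f i) = set0.
Proof.
move=> chimax; have [[[e0 chie0] chiM _] _] := chimax.
elim: n f => [|n IHn] f chif.
  by exists e0 => //; rewrite bigcup0 ?setI0 // => -[].
have [h chih hf] := IHn _ (fun i => chif (lift ord0 i)).
have [h' chih' hf'] := Omega_max_disj chimax (chif ord0).
exists (Jmeet h h'); first by rewrite chiM chih.
apply/seteqP; split=> // x [[hx h'x] [i _]].
case: (unliftP ord0 i) => [j|] -> fx.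
  by rewrite -hf; split=> //; exists j.
by rewrite -hf'.
Qed.

Lemma Omega_max_ev chi a : Omega_max chi -> ev chi a ->
  exists2 h : J, chi h & val h `<=` a.
Proof.
move=> chimax [e [n [f [fe -> chie chif]]]].
have [h chih hf] := Omega_max_disjs chimax chif.
have [[_ chiM _] _] := chimax.
exists (Jmeet h e); first by rewrite chiM chih.
move=> x [hx ex]; split=> // fx.
by have : set0 x by rewrite -hf.
Qed.

Lemma Omega_max_Omega : Omega_max `<=` Omega.
Proof.
move=> chi chimax; have [chiP _] := chimax; split=> // e n f eE chie.
apply: contrapT => nf; have [_ chiM chi0] := chiP.
have [|h chih hf] := @Omega_max_disjs _ _ f chimax.
  by move=> i; apply/negbTE/negP => chif; apply: nf; exists i.
have : chi (Jmeet h e) by rewrite chiM chih.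
by rewrite chi0 //= eE.
Qed.

Lemma Char_nbhs (chi : Char) (e : J) :
  nbhs chi [set psi : Char | psi e = chi e].
Proof.
have /(_ [set b | b = chi e]) := @proj_continuous J (fun=> bool) e chi.
by apply; apply/principal_filterP.
Qed.

Lemma bOmega_Omega : bOmega `<=` Omega.
Proof.
move=> chi [chiP chicl]; split=> // e n f eE chie.
pose U := [set psi : Char | psi e = chi e] `&`
  \bigcap_i [set psi : Char | psi (f i) = chi (f i)].
have /chicl[psi [/Omega_max_Omega[_ psiO] [psie psif]]] : nbhs chi U.
  apply: filterI; first exact: Char_nbhs.
  apply: (@filterS _ _ _ [set psi : Char | forall i, psi (f i) = chi (f i)]).
    by move=> psi psif i _; exact: psif.
  exact: (@filter_forall Char 'I_n
    (fun i => [set psi : Char | psi (f i) = chi (f i)]) (nbhs chi) _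
    (fun i => Char_nbhs chi (f i))).
have [|i] := psiO e n f eE; first by rewrite psie.
by exists i; rewrite -psif.
Qed.

Lemma Ibar_ppreimage s f : Ibar s -> J f -> Jbar (ppreimage s f).
Proof.
move=> [t [eps [tI epsJ _ ->]]] fJ.
have -> : ppreimage (restr t eps) f = (pid f \; t).`1 `&` eps.
  rewrite -ppreimageI; congr (_ `&` _); apply/seteqP; split=> x /=.
    by move=> [y txy fy]; exists y, y.
  by move=> [y [z /= txz [/= fz _]]]; exists z.
apply: JbarI => //; apply: J_Jbar; exists (pid f \; t) => //.
exact: Il_comp (Il_pid fJ) tI.
Qed.

Lemma Il_Ibar : Il `<=` Ibar.
Proof.
move=> s sI; exists s, s.`1; split=> //; first by apply: J_Jbar; exists s.
apply/seteqP; split=> -[x y]; last by move=> /restrE[].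
by move=> sxy; apply/restrE; split=> //; exists y.
Qed.

Lemma Ibar_dom s : Ibar s -> Jbar s.`1.
Proof.
by move=> [t [eps [tI epsJ sub ->]]]; rewrite restr_dom (setIidl sub).
Qed.

Lemma Ibar_partial_bijection : Ibar `<=` @partial_bijection C.
Proof.
move=> _ [s [eps [/Il_partial_bijection[s1 s2] _ _ ->]]].
split=> x y z /restrE[_ sxz] /restrE[_ syz]; [exact: s1 syz|exact: s2 syz].
Qed.

Lemma ev_set0 chi : Omega chi -> ~ ev chi set0.
Proof.
move=> chiO [e [n [f [_ eE chie chif]]]].
have /(Omega_split chiO) : val e `<=` \bigcup_i val (f i).
  by rewrite -setD_eq0 -eE.
by move=> /(_ chie)[i]; rewrite chif.
Qed.

Lemma ev_near chi a : Omega chi -> Jbar a ->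
  \forall psi \near chi, Omega psi -> (ev psi a <-> ev chi a).
Proof.
move=> chiO [e [n [f [fe ->]]]].
apply: (@filterS _ _ _ ([set psi : Char | psi e = chi e] `&`
    [set psi : Char | forall i, psi (f i) = chi (f i)])).
  move=> psi [/= psie psif] psiO; rewrite !evE // psie.
  by split=> -[-> H]; split=> // i; rewrite -?(H i) ?psif.
apply: filterI; first exact: Char_nbhs.
exact: (@filter_forall Char 'I_n
  (fun i => [set psi : Char | psi (f i) = chi (f i)]) (nbhs chi) _
  (fun i => Char_nbhs chi (f i))).
Qed.

Lemma act_Jhat s chi : Ibar s -> Omega chi -> ev chi s.`1 -> Jhat (act s chi).
Proof.
move=> sI chiO chis; have [s1 _] := Ibar_partial_bijection sI.
split.
- have [t [eps [tI _ _ sE]]] := sI.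
  have rJ : J (t^-1).`1 by exists t^-1 => //; exact: Il_inv.
  exists (SigSub (mem_set rJ)); apply/asboolP => /=.
  suff -> : ppreimage s (t^-1).`1 = s.`1 by [].
  apply/seteqP; split=> x /= [y sxy]; exists y => //.
  by move: sxy; rewrite sE => /restrE[_ txy]; exists x.
- move=> e f; apply/asboolP/andP => [evef|[/asboolP eve /asboolP evf]].
    by split; apply/asboolP; apply: (ev_le chiO) evef;
      do ?[exact: Ibar_ppreimage (set_valP _)]; move=> x [y sxy []]; exists y.
  have := ev_meet chiO.1 eve evf; apply: (ev_le chiO).
    exact: Ibar_ppreimage (set_valP _).
  by move=> x [[y sxy ey] [z sxz fz]]; exists y => //; split=> //;
    rewrite (s1 _ _ _ sxy sxz).
- move=> e e0; apply/asboolP; rewrite e0.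
  suff -> : ppreimage s set0 = set0 by exact: ev_set0.
  by apply/seteqP; split=> x // -[].
Qed.

Lemma act_max s chi : Ibar s -> Omega_max chi -> ev chi s.`1 ->
  Omega_max (act s chi).
Proof.
move=> sI chimax chis; have chiO := Omega_max_Omega chimax.
split; first exact: act_Jhat.
move=> psi [_ psiM psi0] le; apply/seteqP; split=> // f /= psif.
apply/asboolP; apply: contrapT => nf.
have [t [eps [tI epsJ epst sE]]] := sI.
have {}chis : ev chi eps by move: chis; rewrite sE restr_dom (setIidl epst).
have fJ := set_valP f.
have pJ : J (ppreimage t (val f)).
  exists (pid (val f) \; t); first exact: Il_comp (Il_pid fJ) tI.
  apply/seteqP; split=> x /=; last by move=> [y txy fy]; exists y, y.
  by move=> [y [z /= txz [/= fz _]]]; exists z.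
have [|h chih hf] := @Omega_max_disj chi (SigSub (mem_set pJ)) chimax.
  apply/negbTE/negP => chip; apply: nf.
  rewrite sE -ppreimageI; apply: (ev_meet chiO.1) => //.
  exact/(ev_J (SigSub (mem_set pJ)) chiO).
have [h' chih' h'eps] := Omega_max_ev chimax chis.
have hJ := set_valP h.
have kJ : J (pimage t (val h)).
  exists (pid (val h) \; t^-1); first exact: Il_comp (Il_pid hJ) (Il_inv tI).
  apply/seteqP; split=> y /=; last by move=> [x hx txy]; exists x, x.
  by move=> [x [z /= tzy [/= hz _]]]; exists z.
pose k : J := SigSub (mem_set kJ).
have psik : psi k.
  apply: le; apply/asboolP => /=.
  have := ev_meet chiO.1 chis (proj2 (ev_J h chiO) chih); apply: (ev_le chiO).
    exact: Ibar_ppreimage.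
  move=> x [epsx hx]; have [y txy] := epst _ epsx.
  by exists y; [rewrite sE; apply/restrE | exists x].
have := psiM k f; rewrite psik psif psi0 //=.
rewrite -subset0 => y /= [[x hx txy] fy].
have : (val h `&` ppreimage t (val f)) x by split=> //; exists y.
by rewrite hf.
Qed.

Lemma act_bOmega s chi : Ibar s -> bOmega chi -> ev chi s.`1 ->
  bOmega (act s chi).
Proof.
move=> sI chib chis; have chiO := bOmega_Omega chib.
split; first exact: act_Jhat.
have actc : act s @ within Omega (nbhs chi) --> (act s chi : Char).
  apply/cvg_sup => f U [V [[W oW <-] /= Wf] VU].
  have fJ := Ibar_ppreimage sI (set_valP f).
  apply: filterS (ev_near chiO fJ) => psi H /H psiE; apply: VU => /=.
  suff -> : act s psi f = act s chi f by [].
  by apply/asboolP/asboolP => /psiE.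
move=> U /actc; rewrite nbhs_simpl /= => sU.
have [psi [psimax [/= psis psiU]]] : (Omega_max `&`
    ([set psi | Omega psi -> ev psi s.`1] `&`
     [set psi | Omega psi -> U (act s psi)])) !=set0.
  apply: chib.2; apply: filterI => //.
  apply: filterS (ev_near chiO (Ibar_dom sI)) => psi H /H psiP.
  exact/psiP.
have psiO := Omega_max_Omega psimax.
exists (act s psi); split; first exact: act_max (psis psiO).
exact: psiU.
Qed.

End InverseHull.

Arguments Il : clear implicits.
Arguments J : clear implicits.
Arguments Jbar : clear implicits.
Arguments Ibar : clear implicits.
Arguments Ibar_f : clear implicits.
Arguments Ibar_c : clear implicits.
Arguments Jhat : clear implicits.
Arguments Omega : clear implicits.
Arguments Omega_max : clear implicits.
Arguments bOmega : clear implicits.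

(** The groupoid of germs of the elements of [S], acting on [bOmega C]. The two
    groupoids of interest are [S = Ibar C] and [S = Il C]; in both cases germs
    are compared on elements of [Jbar C]. By [grange_bOmega] the range map,
    written with values in [Char C], takes its values in [bOmega C]. *)
Section Germs.
Variables (C : lcCategory) (S : set (set (C * C))).
Local Open Scope quotient_scope.
Local Open Scope relation_scope.

Definition pregerm : set (set (C * C) * bOmega C) :=
  [set p | S p.1 /\ ev (val p.2) p.1.`1].

Definition germ_rel (p q : pregerm) : bool :=
  `[< (val p).2 = (val q).2 /\
      exists eps, [/\ Jbar C eps, ev (val (val p).2) eps
                    & restr (val p).1 eps = restr (val q).1 eps] >].

Lemma germ_rel_refl : reflexive germ_rel.
Proof.
move=> p; apply/asboolP; split=> //.
have [_ ps] := set_valP p.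
by exists (val p).1.`1; split=> //; exact: ev_Jbar ps.
Qed.

Lemma germ_rel_sym : symmetric germ_rel.
Proof.
suff H p q : germ_rel p q -> germ_rel q p by move=> p q; apply/idP/idP => /H.
move=> /asboolP[pq [eps [epsJ peps E]]]; apply/asboolP; split=> //.
by exists eps; split=> //; rewrite -pq.
Qed.

Lemma germ_rel_trans : transitive germ_rel.
Proof.
move=> q p r /asboolP[pq [a [aJ pa E]]] /asboolP[qr [b [bJ qb F]]].
apply/asboolP; split; first by rewrite pq.
have chiP : Jhat C (val (val p).2) by have [] := set_valP (val p).2.
exists (a `&` b); split; first exact: JbarI.
  by apply: ev_meet => //; rewrite pq.
by rewrite -restr_restr E restr_restr setIC -restr_restr F restr_restr setIC.
Qed.

Canonical germ_equiv :=
  EquivRel germ_rel germ_rel_refl germ_rel_sym germ_rel_trans.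

Definition germ : Type := {eq_quot germ_equiv}.

HB.instance Definition _ := Choice.on germ.
HB.instance Definition _ := Quotient.on germ.

Definition mk_germ s (chi : bOmega C) (Ss : S s) (chis : ev (val chi) s.`1) :
    germ :=
  \pi_germ (SigSub (mem_set (conj Ss chis : pregerm (s, chi)))).

Definition gsource (g : germ) : bOmega C := (val (repr g)).2.

Definition grange (g : germ) : Char C :=
  act (val (repr g)).1 (val (gsource g)).

(** The unit at [chi] is [[e, chi]] for any [e] in [J] with [chi(e) = 1]. *)
Definition gunits : set germ :=
  [set g | exists e chi (Se : S (pid e)) (chie : ev (val chi) (pid e).`1),
     J C e /\ g = mk_germ Se chie].

(** Isotropy, its interior and the unit space do not involve the product of the
    groupoid, which is therefore not spelled out. *)
Definition isotropy : set germ := [set g | grange g = val (gsource g)].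

(** The part of the groupoid supported on germs of elements of [A]. *)
Definition germs_of (A : set (set (C * C))) : set germ :=
  [set g | exists s chi (Ss : S s) (chis : ev (val chi) s.`1),
     A s /\ g = mk_germ Ss chis].

(** The topology of germs: a set is open when its inverse images under all the
    sections [chi |-> [s, chi]] are open. That these sections are homeomorphisms
    onto open sets is [bisection_open], [gsource_germ], [gsource_continuous] and
    [gsource_open] below. *)
Definition slice s (A : set germ) : set (bOmega C) :=
  [set chi | exists (Ss : S s) (chis : ev (val chi) s.`1), A (mk_germ Ss chis)].

Definition germ_open (A : set germ) : Prop := forall s, open (slice s A).

Lemma ev_open (a : set C) : open [set chi : bOmega C | ev (val chi) a].
Proof.
have [aJ|aJ] := pselect (Jbar C a); last first.
  rewrite (_ : mkset _ = set0); first exact: open0.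
  by rewrite -subset0 => chi /ev_Jbar.
rewrite openE => chi chia.
have chiO := bOmega_Omega (set_valP chi).
have H : nbhs chi [set psi : bOmega C |
    Omega C (val psi) -> ev (val psi) a <-> ev (val chi) a].
  exact: (@initial_continuous _ (Char C) (@set_val _ (bOmega C)) chi _
    (ev_near chiO aJ)).
apply: filterS H => psi /(_ (bOmega_Omega (set_valP psi))) psiE.
exact/psiE.
Qed.

Lemma slice_out s A : ~ S s -> slice s A = set0.
Proof. by move=> Ss; rewrite -subset0 => chi []. Qed.

Lemma germ_openT : germ_open setT.
Proof.
move=> s; have [Ss|Ss] := pselect (S s); last by rewrite slice_out //; exact: open0.
rewrite (_ : slice s setT = [set chi : bOmega C | ev (val chi) s.`1]).
  exact: ev_open.
apply/seteqP; split=> chi; first by move=> [Ss0 []].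
by move=> chis; exists Ss, chis.
Qed.

Lemma germ_openI : setI_closed germ_open.
Proof.
move=> A B Ao Bo s; rewrite (_ : slice s _ = slice s A `&` slice s B).
  exact: openI (Ao s) (Bo s).
apply/seteqP; split=> chi /=.
  by move=> [Ss [chis [? ?]]]; split; exists Ss, chis.
move=> [[Ss [chis Ag]] [Ss' [chis' Bg]]]; exists Ss, chis; split=> //.
by rewrite (Prop_irrelevance Ss Ss') (Prop_irrelevance chis chis').
Qed.

Lemma germ_open_bigU (I : Type) (f : I -> set germ) :
  (forall i, germ_open (f i)) -> germ_open (\bigcup_i f i).
Proof.
move=> fo s; rewrite (_ : slice s _ = \bigcup_i slice s (f i)).
  by apply: bigcup_open => i _; exact: fo.
apply/seteqP; split=> chi /=.
  by move=> [Ss [chis [i _ fg]]]; exists i => //; exists Ss, chis.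
by move=> [i _ [Ss [chis fg]]]; exists Ss, chis, i.
Qed.

HB.instance Definition _ :=
  isOpenTopological.Build germ germ_openT germ_openI germ_open_bigU.

Definition effective : Prop := isotropy° = gunits.

Lemma mk_germ_eq s t (chi psi : bOmega C) (Ss : S s) (St : S t)
    (chis : ev (val chi) s.`1) (psit : ev (val psi) t.`1) :
  mk_germ Ss chis = mk_germ St psit <->
  chi = psi /\ exists eps,
    [/\ Jbar C eps, ev (val chi) eps & restr s eps = restr t eps].
Proof. by split=> [/eqmodP/asboolP|?]; last by apply/eqmodP/asboolP. Qed.

Lemma repr_germ s (chi : bOmega C) (Ss : S s) (chis : ev (val chi) s.`1) :
  (val (repr (mk_germ Ss chis))).2 = chi /\ exists eps, 
    [/\ Jbar C eps, ev (val chi) eps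
      & restr (val (repr (mk_germ Ss chis))).1 eps = restr s eps].
Proof.
have /eqmodP/asboolP[/= e [eps [epsJ epschi E]]] := reprK (mk_germ Ss chis).
split; first by [].
by exists eps; split=> //; rewrite -e.
Qed.

Lemma gsource_germ s (chi : bOmega C) (Ss : S s) (chis : ev (val chi) s.`1) :
  gsource (mk_germ Ss chis) = chi.
Proof. by have [] := repr_germ Ss chis. Qed.

Lemma grange_germ s (chi : bOmega C) (Ss : S s) (chis : ev (val chi) s.`1) :
  S `<=` Ibar C -> grange (mk_germ Ss chis) = act s (val chi).
Proof.
move=> SI; rewrite /grange gsource_germ.
have [_ [eps [epsJ chieps E]]] := repr_germ Ss chis.
have [tS _] := set_valP (repr (mk_germ Ss chis)).
have chiO := bOmega_Omega (set_valP chi).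
apply: funext => f; apply/asboolP/asboolP => evf.
  have := ev_meet chiO.1 evf chieps; rewrite ppreimageI E -ppreimageI.
  by apply: ev_le => //; exact: Ibar_ppreimage (SI _ Ss) (set_valP f).
have := ev_meet chiO.1 evf chieps; rewrite ppreimageI -E -ppreimageI.
by apply: ev_le => //; exact: Ibar_ppreimage (SI _ tS) (set_valP f).
Qed.

Lemma grange_bOmega (g : germ) : S `<=` Ibar C -> bOmega C (grange g).
Proof.
move=> SI; have [gS gev] := set_valP (repr g).
exact: act_bOmega (SI _ gS) (set_valP _) gev.
Qed.

Lemma germ_openP (A : set germ) : open A <-> forall s, open (slice s A).
Proof. by []. Qed.

Lemma bisection_open s (Ss : S s) :
  open [set g : germ | exists chi (chis : ev (val chi) s.`1), g = mk_germ Ss chis].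
Proof.
apply/germ_openP => t; rewrite openE => chi [/= St [chit [psi [psis]]]].
move/mk_germ_eq => [? [eps [epsJ chieps E]]]; subst psi.
have chiO := bOmega_Omega (set_valP chi).
have := open_nbhs_nbhs (conj (openI (ev_open eps) (openI (ev_open t.`1)
  (ev_open s.`1))) (conj chieps (conj chit psis))).
apply: filterS => psi [/= psieps [psit psis']].
exists St, psit, psi, psis'; apply/mk_germ_eq; split=> //.
by exists eps.
Qed.

Lemma gsource_continuous : continuous gsource.
Proof.
apply/continuousP => U oU; apply/germ_openP => s.
have [Ss|Ss] := pselect (S s); last by rewrite slice_out //; exact: open0.
rewrite (_ : slice s _ = U `&` [set chi : bOmega C | ev (val chi) s.`1]).
  exact: openI oU (ev_open _).
apply/seteqP; split=> chi /=.
  by move=> [? [?]] /=; rewrite gsource_germ.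
by move=> [Uchi chis]; exists Ss, chis; rewrite /= gsource_germ.
Qed.

Lemma gsource_open (U : set germ) : open U -> open (gsource @` U).
Proof.
move=> /germ_openP oU; rewrite (_ : _ @` _ = \bigcup_s slice s U).
  by apply: bigcup_open => s _; exact: oU.
apply/seteqP; split=> chi /=; last first.
  move=> [s _ [Ss [chis Ug]]]; exists (mk_germ Ss chis) => //.
  exact: gsource_germ.
move=> [g Ug <-]; exists (val (repr g)).1 => //=.
have [Ss gs] := set_valP (repr g); exists Ss, gs.
suff -> : mk_germ Ss gs = g by [].
rewrite -[RHS]reprK; apply/eqmodP/asboolP => /=; split=> //.
by exists (val (repr g)).1.`1; split=> //; exact: ev_Jbar gs.
Qed.

End Germs.

Arguments isotropy {C} S.
Arguments gunits {C} S.
Arguments germs_of {C} S A.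
Arguments effective {C} S.

(* Main.v *)
From HB Require Import structures.
Require Import Defs.
From mathcomp Require Import all_boot all_classical.
From mathcomp Require Import topology.
From mathcomp Require finmap.

Local Open Scope classical_set_scope.

(** Maximal characters do all the work. By Zorn, every non-empty [e] in [J]
    satisfies [chi(e) = 1] for some maximal [chi] ([Omega_max_ex]), and a
    maximal character takes the value 1 on an element of [Jbar] only if it does
    so on some element of [J] contained in it. Moreover maximal characters are
    dense in [bOmega].

    Interior of the isotropy ([interior_isotropy_Ibar]). Let [s] be in [Ibar_c].
    If [s] moved a maximal character [psi], maximality would give [h], [f] in
    [J] with [h] and [f] disjoint, [psi(f) = 1] and [(s.psi)(h) = 1], hence a
    non-empty [k] in [J], contained in [f], with [s k] contained in [h]; thus
    [k] and [s k] are disjoint, which membership in [Ibar_c] forbids. By density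
    [s] fixes every [chi] in its domain, and the germs of elements of [Ibar_c],
    which form an open set, are isotropic. Conversely, if the germ of [s] at
    [chi] is interior to the isotropy, then [s] fixes all [psi] with
    [psi(eps) = 1], for some [eps] with [chi(eps) = 1]. For non-empty [e] in [J]
    below [eps], a maximal [psi] with [psi(e) = 1] is fixed by [s], so
    [psi(s e) = 1] and [e] meets [s e]: the restriction of [s] to [eps] is in
    [Ibar_c].

    Effectiveness. Whether the germ of [s] at [chi] is interior to the isotropy
    ([interior_isotropyP]), and whether it is a unit ([gunitsP]), is expressed
    without reference to the ambient semigroup. As every germ is represented by
    an element of [Il], effectiveness for [Il] and for [Ibar] is the same
    condition ([effectiveP]).

    The covering condition ([locally_identityP]). If all germs of [s] are units,
    the sets [{chi | chi(eps) = 1}] with [s eps = eps] cover the compact set of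
    those [chi] in [bOmega] that are defined at [s], and a finite subcover gives
    the required family, as seen on maximal characters. Conversely, if some
    [chi] defined at [s] had [chi(eps_i) = 0] for all [i], so would a nearby
    maximal character defined at [s], and this character would provide a
    non-empty [g] in [J] below [s^{-1}s] and disjoint from all the [eps_i]. *)

(** * Characters of [J] *)

Section Characters.
Set Implicit Arguments.
Unset Strict Implicit.
Unset Printing Implicit Defensive.
Local Open Scope relation_scope.
Context {C : lcCategory}.
Implicit Types (chi psi : Char C) (e f g h : J C) (s t : set (C * C)).
Implicit Types (a b eps : set C).

Lemma Jmeet_val e f : val (Jmeet e f) = val e `&` val f.
Proof. by []. Qed.

Lemma Jhat_nonempty chi h : Jhat C chi -> chi h -> val h !=set0.
Proof.
move=> [_ _ chi0] chih; apply/set0P/eqP => h0.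
by move: chih; rewrite chi0.
Qed.

Lemma Jhat_lower_bound chi n (f : 'I_n -> J C) : Jhat C chi ->
  (forall i, chi (f i)) -> exists2 h, chi h & forall i, val h `<=` val (f i).
Proof.
move=> [[e0 chie0] chiM _]; elim: n f => [|n IHn] f chif.
  by exists e0 => // -[].
have [h chih hf] := IHn (fun i => f (lift ord0 i)) (fun i => chif _).
exists (Jmeet h (f ord0)); first by rewrite chiM chih chif.
move=> i x [hx fx].
by case: (unliftP ord0 i) => [j|] -> //; exact: hf.
Qed.

Lemma Omega_max_bOmega : Omega_max C `<=` bOmega C.
Proof. by move=> chi chimax; split; [case: chimax|exact: subset_closure]. Qed.

(** A maximal filter of non-empty elements of [J] containing [e]. The empty set
    is admitted among the candidates, so that the union of an empty chain is
    one. *)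
Lemma Omega_max_ex e : val e !=set0 -> exists2 chi, Omega_max C chi & chi e.
Proof.
move=> e0.
pose P (A : set (J C)) := [/\ A !=set0 -> A e,
  forall f g, A (Jmeet f g) <-> A f /\ A g & forall f, A f -> val f !=set0].
have [F FP Ftot|A [[Ae AM A0] Amax]] := @Zorn_bigcup (J C) P.
  split.
  - move=> [f [A FA Af]]; exists A => //.
    by have [Ae _ _] := FP _ FA; apply: Ae; exists f.
  - move=> f g; split=> [[A FA]|[[A FA Af] [B FB Bg]]].
      have [_ AM _] := FP _ FA.
      by move=> /AM[Af Ag]; split; exists A.
    have [AB|BA] := Ftot _ _ FA FB.
      exists B => //; have [_ BM _] := FP _ FB.
      by apply/BM; split=> //; exact: AB.
    exists A => //; have [_ AM _] := FP _ FA.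
    by apply/AM; split=> //; exact: BA.
  - by move=> f [A FA Af]; have [_ _ A0] := FP _ FA; exact: A0.
have {}Ae : A e.
  apply: contrapT => nAe.
  have A_empty f : ~ A f by move=> Af; apply: nAe; apply: Ae; exists f.
  (* otherwise [A] is empty, hence strictly below the principal filter of [e] *)
  apply: (Amax [set f | val e `<=` val f]).
    split; first by move=> f /A_empty.
    by move=> eA; apply: (A_empty e); exact: eA.
  split; first by move=> _ x.
  - by move=> f g; rewrite /mkset Jmeet_val subsetI.
  - by move=> f /= ef; case: e0 => x /ef; exists x.
exists (fun f => `[< A f >]); last exact/asboolP.
split.
  split.
  - by exists e; apply/asboolP.
  - move=> f g; apply/asboolP/andP => [/AM[Af Ag]|[/asboolP Af /asboolP Ag]].
      by split; apply/asboolP.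
    exact/AM.
  - by move=> f f0; apply/asboolP => /A0/set0P; rewrite f0 eqxx.
move=> psi psiP Apsi; apply: contrapT => npsi.
apply: (Amax [set f | psi f]).
  split; first by move=> f Af; apply: Apsi; apply/asboolP.
  move=> psiA; apply: npsi; apply/seteqP; split=> // f /= /psiA Af.
  exact/asboolP.
split.
- by move=> _; apply: Apsi; exact/asboolP.
- by move=> f g /=; have [_ -> _] := psiP; split=> /andP.
- by move=> f /= psif; exact: Jhat_nonempty psif.
Qed.

Lemma Omega_max_disj_ev chi eps : Omega_max C chi -> Jbar C eps ->
  ~ ev chi eps -> exists2 h, chi h & val h `&` eps = set0.
Proof.
move=> chimax [e [n [f [fe ->]]]] nev.
have chiO := Omega_max_Omega chimax.
case chie : (chi e); last first.
  have [h chih he] := Omega_max_disj chimax chie; exists h => //.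
  by rewrite -subset0 -he => x [hx [ex _]].
have [[i /negP]|/forallNP chif] := pselect (exists i, ~ ~~ chi (f i)).
  rewrite negbK => chif; exists (f i) => //.
  by rewrite -subset0 => x [fx [_]]; apply; exists i.
case: nev; apply/evE => //; split=> // i.
by have /contrapT/negbTE := chif i.
Qed.

Lemma bOmega_ev_sub chi a : bOmega C chi -> ev chi a ->
  exists h, val h !=set0 /\ val h `<=` a.
Proof.
move=> chib chia; have chiO := bOmega_Omega chib.
have [psi [psimax psia]] := chib.2 _ (ev_near chiO (ev_Jbar chia)).
have [|h psih ha] := Omega_max_ev psimax (a := a).
  exact/psia/chia/Omega_max_Omega.
by exists h; split=> //; exact: Jhat_nonempty psimax.1 psih.
Qed.

(** Every neighbourhood of [chi] contains a set [{psi | psi(eps) = 1}] with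
    [eps] in [Jbar] and [chi(eps) = 1]. *)
Lemma bOmega_nbhs (chi : bOmega C) (U : set (bOmega C)) : nbhs chi U ->
  exists2 eps, ev (val chi) eps &
    forall psi : bOmega C, ev (val psi) eps -> U psi.
Proof.
have chiO := bOmega_Omega (set_valP chi).
have [chi0 chiM _] := chiO.1.
pose F := filter_from [set eps | ev (val chi) eps]
  (fun eps => [set psi : Char C | Omega C psi /\ ev psi eps]).
have FF : Filter F.
  apply: filter_from_filter.
    by case: chi0 => e /(ev_J _ chiO); exists (val e).
  move=> a b chia chib; exists (a `&` b); first exact: (ev_meet chiO.1).
  move=> psi [psiO psiab]; split; split=> //; apply: (ev_le psiO) psiab.
  - exact: ev_Jbar chia.
  - exact: subIsetl.
  - exact: ev_Jbar chib.
  - exact: subIsetr.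
have Fchi : F --> (val chi : Char C).
  apply/cvg_sup => f V [W [[B oB <-] /= Bf] BV].
  suff [eps chieps Heps] : exists2 eps, ev (val chi) eps &
      forall psi, Omega C psi -> ev psi eps -> psi f = val chi f.
    exists eps => // psi [psiO psieps].
    by apply: BV; rewrite /= (Heps _ psiO psieps).
  case chif : (val chi f).
    exists (val f); first exact/ev_J.
    by move=> psi psiO /ev_J; apply.
  (* [psi(f) = 0] is expressed as [psi(e \ (e f)) = 1], where [chi(e) = 1] *)
  have [e chie] := chi0.
  have sub psi : Omega C psi ->
      ev psi (val e `\` \bigcup_(i in [set: 'I_1]) val (Jmeet e f)) <->
      psi e /\ forall i : 'I_1, psi (Jmeet e f) = false.
    by move=> psiO; apply: evE => // i; rewrite Jmeet_val; exact: subIsetl.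
  exists (val e `\` \bigcup_(i in [set: 'I_1]) val (Jmeet e f)).
    by apply/sub => //; split=> // _; rewrite chiM chif andbF.
  move=> psi psiO /(sub _ psiO)[psie /(_ ord0)].
  by have [[_ -> _] _] := psiO; rewrite psie.
rewrite nbhsE => -[_ [[V oV <-] Vchi] VU].
have [eps chieps Heps] := Fchi _ (open_nbhs_nbhs (conj oV Vchi)).
exists eps => // psi psieps; apply: VU; apply: Heps; split=> //.
exact: bOmega_Omega (set_valP psi).
Qed.

Lemma pimage_J s e : Ibar C s -> val e `<=` s.`1 -> J C (pimage s (val e)).
Proof.
move=> [t [eps [tI _ _ sE]]] es.
exists (pid (val e) \; t^-1).
  exact: Il_comp (Il_pid (set_valP e)) (Il_inv tI).
apply/seteqP; split=> y /=.
  move=> [x [z /= tzy [/= ez _]]]; exists z => //.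
  have [w] := es _ ez; rewrite sE => /restrE[epsz _].
  exact/restrE.
by move=> [x ex]; rewrite sE => /restrE[_ txy]; exists x, x.
Qed.

Lemma Ibar_restr s eps : Ibar C s -> Jbar C eps -> Ibar C (restr s eps).
Proof.
move=> [t [a [tI aJ sub ->]]] epsJ; exists t, (a `&` eps).
by rewrite restr_restr; split=> //; [exact: JbarI | move=> x [/sub]].
Qed.

Lemma Ibar_c_act_max s psi : Ibar_c C s -> Omega_max C psi -> ev psi s.`1 ->
  act s psi = psi.
Proof.
move=> [[sI _] sc] psimax psis; have psiO := Omega_max_Omega psimax.
have actmax := act_max sI psimax psis.
suff le : [set e | psi e] `<=` [set e | act s psi e].
  have E := psimax.2 _ actmax.1 le; apply/funext => f.
  have {}E : (act s psi f : Prop) = psi f.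
    exact: (congr1 (fun A : set (J C) => A f) E).
  by apply/idP/idP; rewrite E.
move=> f /= psif; apply: contrapT => /negP/negbTE nf.
have [h] := Omega_max_disj actmax nf.
move=> /asboolP evh hf.
have [k psik] := Omega_max_ev psimax
  (ev_meet psiO.1 evh (proj2 (ev_J f psiO) psif)).
rewrite subsetI => -[kh kf].
have [|y [ky [x kx sxy]]] := sc _ (set_valP k) (Jhat_nonempty psimax.1 psik).
  by move=> x /kh[y sxy _]; exists y.
have [z sxz hz] := kh _ kx.
have [s1 _] := Ibar_partial_bijection sI.
have : (val h `&` val f) y.
  by split; [rewrite (s1 _ _ _ sxy sxz) | exact: kf].
by rewrite hf.
Qed.

Lemma Ibar_c_act s chi : Ibar_c C s -> bOmega C chi -> ev chi s.`1 ->
  act s chi = chi.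
Proof.
move=> sc chib chis; have chiO := bOmega_Omega chib; have [[sI _] _] := sc.
apply/funext => f.
have [psi [psimax [/= psif [psis psisf]]]] := chib.2 _
  (filterI (Char_nbhs chi f) (filterI (ev_near chiO (Ibar_dom sI))
    (ev_near chiO (Ibar_ppreimage sI (set_valP f))))).
have psiO := Omega_max_Omega psimax.
rewrite -psif -[in RHS](Ibar_c_act_max sc psimax); last exact/psis.
by apply/asboolP/asboolP => /(psisf psiO).
Qed.

Lemma Char_open e (b : bool) : open [set chi : Char C | chi e = b].
Proof.
rewrite openE => chi chie; apply: filterS (Char_nbhs chi e) => psi /= ->.
exact: chie.
Qed.

Lemma Char_closed e (b : bool) : closed [set chi : Char C | chi e = b].
Proof.
rewrite -openC (_ : ~` _ = [set chi : Char C | chi e = ~~ b]).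
  exact: Char_open.
by apply/seteqP; split=> chi /=; case: (chi e) b => -[].
Qed.

Lemma ev_Char_open a : open [set chi : Char C | ev chi a].
Proof.
rewrite openE => chi [e [n [f [fe aE chie chif]]]].
suff : nbhs chi ([set psi : Char C | psi e = chi e] `&`
    [set psi : Char C | forall i, psi (f i) = chi (f i)]).
  apply: filterS => psi [/= psie psif]; exists e, n, f; split=> //.
    by rewrite psie.
  by move=> i; rewrite psif.
apply: filterI; first exact: Char_nbhs.
exact: (@filter_forall (Char C) 'I_n
  (fun i => [set psi : Char C | psi (f i) = chi (f i)]) (nbhs chi) _
  (fun i => Char_nbhs chi (f i))).
Qed.

(** In the space of all maps [J -> bool], the zero map may be adherent to the
    maximal characters; it is the only such point outside [Jhat]. *)
Lemma closure_Omega_max_Jhat chi e : closure (Omega_max C) chi -> chi e ->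
  Jhat C chi.
Proof.
move=> chicl chie; split.
- by exists e.
- move=> f g.
  have [psi [[[_ psiM _] _] [/= fg [f' g']]]] := chicl _
    (filterI (Char_nbhs chi (Jmeet f g))
      (filterI (Char_nbhs chi f) (Char_nbhs chi g))).
  by rewrite -fg -f' -g'.
- move=> f f0; have [psi [[[_ _ psi0] _] /= <-]] := chicl _ (Char_nbhs chi f).
  exact: psi0.
Qed.

Lemma bOmega_compact a : Jbar C a ->
  compact [set chi : Char C | bOmega C chi /\ ev chi a].
Proof.
move=> [e [n [f [fe ->]]]].
rewrite (_ : mkset _ = closure (Omega_max C) `&`
    ([set chi : Char C | chi e = true] `&`
     \bigcap_i [set chi : Char C | chi (f i) = false])).
  have cT : compact [set: Char C].
    have := @tychonoff (J C) (fun=> bool) (fun=> setT) (fun=> bool_compact).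
    by congr compact; apply/seteqP; split.
  apply: subclosed_compact cT _ => //.
  apply: closedI; first exact: closed_closure.
  apply: closedI; first exact: Char_closed.
  by apply: closed_bigI => i _; exact: Char_closed.
apply/seteqP; split=> chi.
  move=> [chib eva].
  have [chie chif] := proj1 (evE (bOmega_Omega chib) fe) eva.
  by split; [exact: chib.2|split=> // i _; exact: chif].
move=> [chicl [/= chie chif]].
have chib : bOmega C chi by split=> //; exact: closure_Omega_max_Jhat chie.
split=> //; apply/evE => //; first exact: bOmega_Omega.
by split=> // i; exact: chif.
Qed.

Lemma bOmega_finite_cover a (E : set (set C)) : Jbar C a ->
  (forall chi, bOmega C chi -> ev chi a -> exists2 eps, E eps & ev chi eps) ->
  exists n (eps : 'I_n -> set C), (forall i, E (eps i)) /\
    forall chi, bOmega C chi -> ev chi a -> exists i, ev chi (eps i).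
Proof.
move=> aJ cov; have := bOmega_compact aJ.
(* [compact_cover] is stated for pointed spaces *)
pose PChar : ptopologicalType := HB.pack_for ptopologicalType
  {ptws J C -> bool} (isPointed.Build {ptws J C -> bool} (fun=> false)).
rewrite (@compact_cover PChar).
move=> /(_ _ E (fun eps => [set chi : Char C | ev chi eps])).
case=> [eps _||D DE Dcov]; first exact: ev_Char_open.
  by move=> chi [/cov/[apply]-[eps ? ?]]; exists eps.
pose r : seq (set C) := finmap.enum_fset D.
exists (size r), (fun i => nth set0 r i); split.
  by move=> i; apply/set_mem/DE; rewrite mem_nth.
move=> chi chib chia; have [//|eps /= epsD evchi] := Dcov chi.
have ieps : index eps r < size r by rewrite index_mem.
by exists (Ordinal ieps); rewrite /= nth_index.
Qed.

End Characters.

(** * Germs *)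

Section Germs.
Set Implicit Arguments.
Unset Strict Implicit.
Unset Printing Implicit Defensive.
Local Open Scope relation_scope.
Context {C : lcCategory}.
Implicit Types (chi psi : bOmega C) (e f g h : J C) (s t : set (C * C)).
Implicit Types (a b eps : set C).

(** [s] fixes all the characters near [chi] in its domain; equivalently, the
    germ of [s] at [chi] is interior to the isotropy: [interior_isotropyP]. *)
Definition locally_fixes s chi : Prop :=
  nbhs chi
    [set psi : bOmega C | ev (val psi) s.`1 -> act s (val psi) = val psi].

(** [s] is the identity on some [eps] with [chi(eps) = 1]; equivalently, the
    germ of [s] at [chi] is a unit, see [gunitsP]. *)
Definition locally_identity s chi : Prop :=
  exists eps, [/\ Jbar C eps, ev (val chi) eps & restr s eps = pid eps].

Lemma restr_pid a : restr (pid a) a = pid a.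
Proof. by rewrite /restr pidI setIid. Qed.

Lemma restr_pidS s a b : b `<=` a -> restr s a = pid a -> restr s b = pid b.
Proof.
move=> ba sa; rewrite -{1}(setIidr ba) -restr_restr sa.
apply/seteqP; split=> -[x y]; first by move=> /restrE[bx [/= _ xy]].
by move=> [/= bx xy]; apply/restrE; split=> //; split=> //; exact: ba.
Qed.

Section Germ.
Variables (S : set (set (C * C))).
Hypotheses (IlS : Il C `<=` S) (SIbar : S `<=` Ibar C).

(** Every germ is represented by an element of [Il], as an element of [Ibar] is
    the restriction of one. *)
Lemma germE (g : germ S) : exists s chi (Ss : S s) (chis : ev (val chi) s.`1),
  Il C s /\ g = mk_germ Ss chis.
Proof.
have [Ss gs] := set_valP (repr g).
have [t [eps [tI epsJ epst sE]]] := SIbar Ss.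
have epsev : ev (val (val (repr g)).2) eps.
  by move: gs; rewrite {1}sE restr_dom (setIidl epst).
have chit : ev (val (val (repr g)).2) t.`1.
  apply: ev_le epsev => //; first exact/bOmega_Omega/set_valP.
  exact: Ibar_dom (Il_Ibar tI).
exists t, (val (repr g)).2, (IlS tI), chit; split=> //.
rewrite -[LHS]reprK; apply/eqmodP/asboolP => /=; split=> //.
by exists eps; split=> //; rewrite sE restr_restr setIid.
Qed.

Lemma gunitsP s chi (Ss : S s) (chis : ev (val chi) s.`1) :
  gunits S (mk_germ Ss chis) <-> locally_identity s chi.
Proof.
have chiO := bOmega_Omega (set_valP chi).
split.
  move=> [e [psi [Se [psie [eJ /mk_germ_eq[? [eps [epsJ chieps E]]]]]]]].
  subst psi.
  have chie : ev (val chi) e by move: psie; rewrite pid_dom.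
  exists (e `&` eps).
  split; [exact: JbarI (J_Jbar eJ) epsJ | exact: (ev_meet chiO.1) |].
  rewrite setIC -restr_restr E restr_restr.
  exact: restr_pidS (@subIsetr _ _ _) (restr_pid _).
move=> [eps [epsJ chieps E]].
have [[e chie] _ _] := chiO.1; move/(ev_J _ chiO) in chie.
have eJ := set_valP e.
have chie' : ev (val chi) (pid (val e)).`1 by rewrite pid_dom.
exists (val e), chi, (IlS (Il_pid eJ)), chie'; split=> //.
apply/mk_germ_eq; split=> //; exists (val e `&` eps).
split; [exact: JbarI (J_Jbar eJ) epsJ | exact: (ev_meet chiO.1) |].
rewrite (restr_pidS (@subIsetr _ _ _) E).
by rewrite (restr_pidS (@subIsetl _ _ _) (restr_pid _)).
Qed.

Lemma interior_isotropyP s chi (Ss : S s) (chis : ev (val chi) s.`1) :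
  (isotropy S)° (mk_germ Ss chis) <-> locally_fixes s chi.
Proof.
split.
  rewrite interiorEbigcup => -[U [/germ_openP oU Uiso] Ug].
  have : nbhs chi (slice s U).
    by apply: open_nbhs_nbhs; split=> //; exists Ss, chis.
  apply: filterS => psi [Ss' [psis /Uiso]]; rewrite /isotropy /=.
  by rewrite grange_germ // gsource_germ.
pose F : set (bOmega C) :=
  [set psi : bOmega C | ev (val psi) s.`1 -> act s (val psi) = val psi].
move=> /(@nbhs_interior _ _ F) chifix; rewrite interiorEbigcup.
exists ([set g : germ S |
      exists psi (psis : ev (val psi) s.`1), g = mk_germ Ss psis] `&`
    gsource (S := S) @^-1` F°).
  split.
    apply: openI; first exact: bisection_open.
    have /continuousP := @gsource_continuous C S; apply.
    exact: open_interior.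
  move=> _ [[psi [psis ->]]] /=.
  rewrite gsource_germ => /interior_subset /(_ psis).
  by rewrite /isotropy /= grange_germ // gsource_germ.
split; first by exists chi, chis.
rewrite /= gsource_germ; exact: nbhs_singleton chifix.
Qed.

Lemma effectiveP : effective S <->
  forall s chi, Il C s -> ev (val chi) s.`1 ->
    (locally_fixes s chi <-> locally_identity s chi).
Proof.
split=> [eff s chi sI chis|H].
  by rewrite -(interior_isotropyP (IlS sI) chis) eff gunitsP.
apply/seteqP; split=> g; have [s [chi [Ss [chis [sI ->]]]]] := germE g.
  by move=> /interior_isotropyP/(H _ _ sI chis)/gunitsP; apply.
by move=> /gunitsP/(H _ _ sI chis)/interior_isotropyP; apply.
Qed.

End Germ.

(** * The interior of the isotropy and effectiveness *)

Lemma interior_isotropy_Ibar :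
  (isotropy (Ibar C))° = germs_of (Ibar C) (Ibar_c C).
Proof.
apply/seteqP; split=> g.
  have [s [chi [Ss [chis [_ ->]]]]] := germE (@Il_Ibar C) (fun _ => id) g.
  move=> /interior_isotropyP -/(_ (fun _ => id))/bOmega_nbhs[eps0 chieps0 fix0].
  have chiO := bOmega_Omega (set_valP chi).
  pose eps := eps0 `&` s.`1.
  have chieps : ev (val chi) eps by exact: (ev_meet chiO.1).
  have epsJ := ev_Jbar chieps.
  have tdom : (restr s eps).`1 = eps.
    by rewrite restr_dom (setIidl (@subIsetr _ _ _)).
  have tI := Ibar_restr Ss epsJ.
  have chit : ev (val chi) (restr s eps).`1 by rewrite tdom.
  exists (restr s eps), chi, tI, chit; split; last first.
    by apply/mk_germ_eq; split=> //; exists eps; rewrite restr_restr setIid.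
  split.
    split=> //; have [h [h0 heps]] := bOmega_ev_sub (set_valP chi) chieps.
    by exists (val h); split=> //; [exact: set_valP | rewrite tdom].
  move=> e eJ e0; rewrite tdom => es.
  pose e' : J C := SigSub (mem_set eJ).
  have [psi psimax psie] := @Omega_max_ex C e' e0.
  have psiO := Omega_max_Omega psimax.
  have psib := Omega_max_bOmega psimax.
  have psieps : ev psi eps by apply: (ev_le psiO epsJ es); exact/(ev_J e' psiO).
  have psis : ev psi s.`1 by apply: (ev_le psiO (Ibar_dom Ss)) psieps => x [].
  have psieps0 : ev psi eps0.
    by apply: (ev_le psiO (ev_Jbar chieps0)) psieps => x [].
  have fixpsi : act s psi = psi :=
    fix0 (SigSub (mem_set psib)) psieps0 psis.
  have es' : e `<=` s.`1 by move=> x /es[].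
  pose k : J C := SigSub (mem_set (@pimage_J _ s e' Ss es')).
  have psik : psi k.
    rewrite -fixpsi; apply/asboolP.
    apply: (ev_le psiO (Ibar_ppreimage Ss (set_valP k)))
      (proj2 (ev_J e' psiO) psie).
    by move=> x ex; have [y sxy] := es' _ ex; exists y => //; exists x.
  have [|y [ey [x ex sxy]]] := Jhat_nonempty psimax.1 (h := Jmeet e' k).
    by have [[_ -> _] _] := psimax; rewrite psie.
  by exists y; split=> //; exists x => //; apply/restrE; split=> //; exact: es.
move=> [s [chi [Ss [chis [sc ->]]]]].
apply/interior_isotropyP => //.
apply: (@filterS _ _ _ setT) filterT => psi _.
exact: Ibar_c_act (set_valP psi).
Qed.

Lemma effective_Il_Ibar : effective (Il C) <-> effective (Ibar C).
Proof.
rewrite effectiveP //; last exact: Il_Ibar.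
by rewrite effectiveP //; exact: Il_Ibar.
Qed.

Lemma germs_of_Ibar_c_gunits :
  germs_of (Ibar C) (Ibar_c C) = gunits (Ibar C) <->
  forall s chi, Ibar_c C s -> ev (val chi) s.`1 -> locally_identity s chi.
Proof.
have IlI := @Il_Ibar C.
split=> [E s chi sc chis|H].
  have sI : Ibar C s by case: sc => -[].
  by apply/(gunitsP IlI sI chis); rewrite -E; exists s, chi, sI, chis.
apply/seteqP; split=> g.
  by move=> [s [chi [Ss [chis [sc ->]]]]]; apply/gunitsP => //; exact: H.
move=> [e [chi [Se [chie [eJ ->]]]]].
exists (pid e), chi, Se, chie; split=> //.
have eh : (e : set C) !=set0.
  move: chie; rewrite pid_dom => chie.
  have [h [[x hx] he]] := bOmega_ev_sub (set_valP chi) chie.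
  by exists x; exact: he.
split; first by split=> //; exists e; rewrite pid_dom; split=> // x.
move=> f fJ [x fx]; rewrite pid_dom => fe; exists x; split=> //.
by exists x => //; split=> //; exact: fe.
Qed.

Lemma locally_identityP :
  (forall s chi, Ibar_c C s -> ev (val chi) s.`1 -> locally_identity s chi) <->
  forall s : set (C * C), Ibar_c C s ->
    exists (n : nat) (eps : 'I_n -> set C),
      (forall i, Jbar C (eps i) /\ restr s (eps i) = pid (eps i)) /\
      forall g : set C, J C g -> g !=set0 -> g `<=` s.`1 ->
        exists i, (g `&` eps i) !=set0.
Proof.
split=> H s.
  move=> sc; have sJ : Jbar C s.`1 by apply: Ibar_dom; case: sc => -[].
  have [|n [eps [epsP cov]]] := @bOmega_finite_cover C s.`1
      [set eps | Jbar C eps /\ restr s eps = pid eps] sJ.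
    move=> chi chib chis.
    have [eps [? ? ?]] := H s (SigSub (mem_set chib)) sc chis.
    by exists eps.
  exists n, eps; split=> // g gJ g0 gs.
  pose g' : J C := SigSub (mem_set gJ).
  have [psi psimax psig] := @Omega_max_ex C g' g0.
  have psiO := Omega_max_Omega psimax.
  have psig' : ev psi g by exact/(ev_J g' psiO).
  have [|i psii] := cov psi (Omega_max_bOmega psimax).
    exact: ev_le psig'.
  exists i; have [h psih hi] := Omega_max_ev psimax (ev_meet psiO.1 psig' psii).
  have [x hx] := Jhat_nonempty psimax.1 psih.
  by exists x; exact: hi.
move=> chi sc chis; have [n [eps [epsP epsg]]] := H s sc.
apply: contrapT => nid.
have chib := set_valP chi.
have chiO := bOmega_Omega chib.
have sJ := ev_Jbar chis.
have nchi i : ~ ev (val chi) (eps i).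
  by move=> evi; apply: nid; have [? ?] := epsP i; exists (eps i).
have [psi [psimax [/= psis psieps]]] := chib.2 _ (filterI (ev_near chiO sJ)
  (@filter_forall (Char C) 'I_n (fun i => [set psi : Char C |
     Omega C psi -> (ev psi (eps i) <-> ev (val chi) (eps i))])
  (nbhs (val chi)) _
  (fun i => ev_near chiO (epsP i).1))).
have psiO := Omega_max_Omega psimax.
have [h psih hs] := Omega_max_ev psimax (proj2 (psis psiO) chis).
have disj i : exists2 k, psi k & val k `&` eps i = set0.
  apply: Omega_max_disj_ev => //; first by case: (epsP i).
  by move=> /(psieps i psiO); exact: nchi.
have [k kP] : {k & forall i, psi (k i) /\ val (k i) `&` eps i = set0}.
  apply: (choice (P := fun i h => psi h /\ val h `&` eps i = set0)) => i.
  by have [h1 ? ?] := disj i; exists h1.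
have [g psig gk] := Jhat_lower_bound psimax.1 (fun i => (kP i).1).
have psihg : psi (Jmeet h g) by have [[_ -> _] _] := psimax; rewrite psih.
have [||i [x [[hx gx] epsx]]] := epsg _ (set_valP (Jmeet h g)).
- exact: Jhat_nonempty psimax.1 psihg.
- by move=> x [hx _]; exact: hs.
have : (val (k i) `&` eps i) x by split=> //; exact: gk.
by rewrite (kP i).2.
Qed.

End Germs.

Theorem theorem5p18 (C : lcCategory) :
  (isotropy (Ibar C))° = germs_of (Ibar C) (Ibar_c C) /\
  [/\ effective (Il C) <-> effective (Ibar C),
      effective (Ibar C) <->
        germs_of (Ibar C) (Ibar_c C) = gunits (Ibar C)
    & germs_of (Ibar C) (Ibar_c C) = gunits (Ibar C) <->
        forall s : set (C * C), Ibar_c C s ->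
          exists (n : nat) (eps : 'I_n -> set C),
            (forall i, Jbar C (eps i) /\ restr s (eps i) = pid (eps i)) /\
            forall g : set C, J C g -> g !=set0 -> g `<=` s.`1 ->
              exists i, (g `&` eps i) !=set0].
Proof.
have iso := @interior_isotropy_Ibar C.
split=> //; split; first exact: effective_Il_Ibar.
  by rewrite /effective iso.
by rewrite germs_of_Ibar_c_gunits locally_identityP.
Qed.
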